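(* Let $n$ be a positive integer with binary expansion $n=\sum_k b_k2^k$ ($b_k\in\{0,1\}$), and let $m=m(n)$ be the first index $k$ for which $b_k\neq s_k$; if no such index exists, let $m=\infty$. Then \[\nu_2\bigl(B^{\pm}(24n+14)\bigr)=m+5.\]
   Context: $S(n,k)$ denotes the Stirling numbers of the second kind and $B^{\pm}(n)=\sum_{k=0}^n(-1)^kS(n,k)$. $\nu_2(a)$ is the $2$-adic valuation of the integer $a$, with $\nu_2(0)=\infty$, and $\infty+5=\infty$. Define integers $y_m$, $m\geq 0$, by $y_0=1$ and $y_{m+1}=y_m$ if $\nu_2(B^{\pm}(24y_m+14))>m+5$, and $y_{m+1}=2^m+y_m$ if $\nu_2(B^{\pm}(24y_m+14))\leq m+5$. Then $y_m\le 2^m-1$ for $m\ge1$ and the binary expansion of $y_{m+1}$ agrees with that of $y_m$ in positions $0,\dots,m-1$; hence for each $i\geq 0$ the $i$-th binary digit of $y_m$ is the same for all $m>i$, and $s_i$ denotes this common digit. The sequence $s=(s_0,s_1,s_2,\dots)$ is the resulting infinite binary sequence. *)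

(* Defs.v *)
From mathcomp Require Import all_boot all_order all_algebra.
From mathcomp Require Import boolp.

Set Implicit Arguments.
Unset Strict Implicit.
Unset Printing Implicit Defensive.

Import GRing.Theory.
Local Open Scope ring_scope.

Fixpoint stirling2 (n k : nat) : nat :=
  match n, k with
  | 0, 0 => 1
  | 0, _.+1 => 0
  | _.+1, 0 => 0
  | n'.+1, k'.+1 => (k'.+1 * stirling2 n' k'.+1 + stirling2 n' k')%N
  end.

Definition Bpm (n : nat) : int :=
  \sum_(0 <= k < n.+1) (-1) ^+ k * (stirling2 n k)%:Z.

(* Extended naturals: [None] is infinity. *)
Definition enat := option nat.

Definition enat_addn (x : enat) (d : nat) : enat := omap (addn^~ d) x.

Definition enat_gtn (x : enat) (d : nat) : bool :=
  if x is Some e then (d < e)%N else true.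

Definition nu2 (a : int) : enat :=
  if a == 0 then None else Some (logn 2 `|a|%N).

Fixpoint y (m : nat) : nat :=
  if m is m'.+1 then
    if enat_gtn (nu2 (Bpm (24 * y m' + 14)%N)) (m' + 5)%N then y m'
    else (2 ^ m' + y m')%N
  else 1%N.

Definition bit (n k : nat) : bool := odd (n %/ 2 ^ k)%N.

(* The choice of y_{i+1} is immaterial: see [sE] below. *)
Definition s (i : nat) : bool := bit (y i.+1) i.

Definition first_diff (b c : nat -> bool) : enat :=
  match pselect (exists k, b k != c k) with
  | left h => Some (ex_minn h)
  | right _ => None
  end.

Definition mindex (n : nat) : enat := first_diff (bit n) s.

(* Rows of the Stirling triangle modulo 64, small enough to compute with. *)
Fixpoint next_row (p k : nat) (r : seq nat) : seq nat :=
  if r is x :: r' then ((k * x + p) %% 64)%N :: next_row x k.+1 r' else [::].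

Definition row64 (N n : nat) : seq nat :=
  iter n (next_row 0 0) (1%N :: nseq N 0%N).

Lemma nth_next_row p k r i : (i < size r)%N ->
  nth 0%N (next_row p k r) i =
  (((k + i) * nth 0 r i + (if i is i'.+1 then nth 0 r i' else p)) %% 64)%N.
Proof.
elim: r p k i => [|x r IHr] p k [|i] //= lti; first by rewrite addn0.
by rewrite IHr // addSnnS; case: i {lti}.
Qed.

Lemma size_next_row p k r : size (next_row p k r) = size r.
Proof. by elim: r p k => //= x r IHr p k; rewrite IHr. Qed.

Lemma row64E N n i : (i <= N)%N ->
  nth 0%N (row64 N n) i = (stirling2 n i %% 64)%N.
Proof.
have szr k : size (row64 N k) = N.+1.
  elim: k => [|k IHk]; first by rewrite /= size_nseq.
  by rewrite /row64 iterS size_next_row.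
elim: n i => [|n IHn] i leiN.
  by case: i leiN => [|i] //= _; rewrite nth_nseq; case: ifP; rewrite mod0n.
rewrite /row64 iterS nth_next_row ?szr // -/(row64 N n) add0n IHn //.
case: i leiN => [|i] leiN; first by rewrite mul0n mod0n.
by rewrite IHn 1?ltnW //= modnDmr -modnDml modnMmr modnDml.
Qed.

Lemma dvd64_Bpm38 : (64 %| Bpm 38)%Z.
Proof.
pose F k : int := (-1) ^+ k * (nth 0%N (row64 38 38) k)%:Z.
have -> : Bpm 38 = (Bpm 38 - \sum_(0 <= k < 39) F k) + \sum_(0 <= k < 39) F k.
  by rewrite subrK.
apply: rpredD; last by rewrite unlock; vm_compute.
rewrite /Bpm -sumrB big_nat; apply: rpred_sum => k /andP[_ ltk].
rewrite /F -mulrBr dvdz_mull // row64E //.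
by rewrite {1}(divn_eq (stirling2 38 k) 64) PoszD addrK PoszM dvdz_mull.
Qed.

Lemma yS m : y m.+1 =
  if enat_gtn (nu2 (Bpm (24 * y m + 14)%N)) (m + 5)%N then y m
  else (2 ^ m + y m)%N.
Proof. by []. Qed.

Lemma nu2_Bpm38 : enat_gtn (nu2 (Bpm 38)) 5.
Proof.
rewrite /nu2; case: eqP => //= /eqP B0.
have : (2 ^ 6 %| `|Bpm 38|)%N := dvd64_Bpm38.
by rewrite pfactor_dvdn // absz_gt0.
Qed.

Lemma y1 : y 1 = 1%N.
Proof. by rewrite yS -[(24 * y 0 + 14)%N]/38%N nu2_Bpm38. Qed.

Lemma y_lt m : (y m.+1 < 2 ^ m.+1)%N.
Proof.
elim: m => [|m IHm]; first by rewrite y1.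
have lt2 : (y m.+1 < 2 ^ m.+2)%N by rewrite (leq_trans IHm) // leq_exp2l.
rewrite yS; case: ifP => // _.
by rewrite [X in (_ < X)%N]expnS mul2n -addnn ltn_add2l.
Qed.

Lemma bit_yS m i : (i <= m)%N -> bit (y m.+2) i = bit (y m.+1) i.
Proof.
move=> leim; rewrite yS; case: ifP => // _.
rewrite /bit -(subnK (leq_trans leim (leqnSn m))) expnD divnMDl ?expn_gt0 //.
by rewrite oddD oddX /= subSn.
Qed.

Lemma sE i m : (i < m)%N -> bit (y m) i = s i.
Proof.
move=> /subnKC <-; elim: (m - i.+1)%N => [|d IHd]; first by rewrite addn0.
by rewrite addnS addSn bit_yS ?leq_addr // -addSn IHd.
Qed.

(* Main.v *)
From Stdlib Require Import ZArith.
From HB Require Import structures.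
Require Import Defs.
From mathcomp Require Import all_boot all_order all_algebra.
From mathcomp Require Import boolp ssrZ zify ring.

(** Let [L] be the linear functional on [Z[X]] with [L(X^n) = Bpm n]; it
    satisfies [L(X p(X)) = - L(p(X+1))], so for [q = X^2 - X - 1] we get
    [L(q p) = L(p(X+2) - p(X))].  Giving [q] weight 1 and the number 2 weight 2,
    this forces [2^ceil(t/2)] to divide [L] of everything of weight at least
    [t].  Now [X^3 - 1 = (X+1) q + 2 X] has weight 1, and repeated squaring shows
    that [w_m = X^(24 * 2^m) - 1] has weight [2m + 6].  Since
    [w_(m+1) = w_m^2 + 2 w_m], induction on [m] yields
    [f(n + 2^m) = f(n) + 2^(m+5)] modulo [2^(m+6)] for [f(n) = Bpm(24 n + 14)],
    the base case being a computation with [Bpm 14], [Bpm 38] and [Bpm 62].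
    Hence [f/32] preserves 2-adic distances, and [s] lists the digits of its
    unique 2-adic zero. *)

Set Implicit Arguments.
Unset Strict Implicit.
Unset Printing Implicit Defensive.

Import GRing.Theory.
Local Open Scope ring_scope.

(** * The functional [X^n |-> Bpm n] *)

Lemma stirling2_gt n k : (n < k)%N -> stirling2 n k = 0%N.
Proof.
elim: n k => [|n IHn] [|k] //= ltnk.
by rewrite !IHn ?muln0 // ltnW.
Qed.

(** Count partitions by the [j] points outside the block of a distinguished point; formally,
    induction on [n] with Pascal's rule. *)
Lemma stirling2_binomial n k :
  stirling2 n.+1 k.+1 = (\sum_(j < n.+1) 'C(n, j) * stirling2 j k)%N.
Proof.
elim: n k => [|n IHn] k.
  by rewrite big_ord1 bin0 mul1n /= muln0.
rewrite big_ord_recl bin0 mul1n.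
under eq_bigr => j _ do rewrite lift0 binS mulnDl.
rewrite big_split /= addnA.
have -> : (stirling2 0 k + \sum_(i < n.+1) 'C(n, i.+1) * stirling2 i.+1 k
           = stirling2 n.+1 k.+1)%N.
  rewrite IHn [RHS]big_ord_recl bin0 mul1n big_ord_recr /= bin_small //.
  by rewrite mul0n addn0.
case: k => [|k].
  rewrite big1 => [|j _]; last by rewrite muln0.
  by rewrite mul1n.
under eq_bigr => j _ do rewrite /= mulnDr mulnCA.
rewrite big_split /= -big_distrr /= -!IHn /=; ring.
Qed.

Lemma Bpm_widen n N : (n <= N)%N ->
  Bpm n = \sum_(k < N.+1) (-1) ^+ k * (stirling2 n k)%:Z.
Proof.
move=> leN.
rewrite -(big_mkord xpredT (fun k => (-1) ^+ k * (stirling2 n k)%:Z)).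
rewrite (big_cat_nat (n := n.+1)) //= [X in _ + X]big1_seq ?addr0 // => k /=.
by rewrite mem_index_iota => /andP[ltnk _]; rewrite stirling2_gt // mulr0.
Qed.

Lemma Bpm_binomial n :
  Bpm n.+1 = - \sum_(j < n.+1) (Bpm j) *+ 'C(n, j).
Proof.
rewrite (Bpm_widen (leqnn _)) big_ord_recl mulr0 add0r.
under eq_bigr => k _ do
  rewrite lift0 exprS mulN1r mulNr stirling2_binomial -natz natr_sum mulr_sumr.
rewrite sumrN exchange_big /=; congr (- _); apply: eq_bigr => j _.
rewrite (Bpm_widen (N := n)) -1?ltnS // -sumrMnl; apply: eq_bigr => k _.
by rewrite natrM natz natz -mulr_natl natz mulrCA.
Qed.

Definition umbral (p : {poly int}) : int := \sum_(i < size p) p`_i * Bpm i.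

Lemma umbral_widen (p : {poly int}) n : (size p <= n)%N ->
  umbral p = \sum_(i < n) p`_i * Bpm i.
Proof.
move=> lepn; rewrite -(big_mkord xpredT (fun i => p`_i * Bpm i)).
rewrite (big_cat_nat (n := size p)) //= big_mkord.
rewrite [X in _ + X]big1_seq ?addr0 // => k /=.
by rewrite mem_index_iota => /andP[lepk _]; rewrite nth_default // mul0r.
Qed.

Lemma umbral_is_scalar : scalar umbral.
Proof.
move=> a p p'; pose n := maxn (size (a *: p + p')) (maxn (size p) (size p')).
rewrite !(@umbral_widen _ n) /n ?leq_max ?leqnn ?orbT //.
rewrite mulr_sumr -big_split; apply: eq_bigr => i _ /=.
by rewrite coefD coefZ mulrDl mulrA.
Qed.

HB.instance Definition _ :=
  GRing.isLinear.Build int {poly int} int *%R umbral umbral_is_scalar.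

Lemma umbralXn n : umbral 'X^n = Bpm n.
Proof.
rewrite /umbral size_polyXn big_ord_recr big1 /= => [|i _].
  by rewrite coefXn eqxx mul1r add0r.
by rewrite coefXn ltn_eqF // mul0r.
Qed.

(** By linearity it suffices to treat monomials, where this is [Bpm_binomial] read through the
    expansion of [(X + 1)^i]. *)
Lemma umbralMX p : umbral ('X * p) = - umbral (p \Po ('X + 1)).
Proof.
rewrite -{1}(coefK p) poly_def mulr_sumr linear_sum comp_polyE linear_sum -sumrN.
apply: eq_bigr => i _.
rewrite -scalerAr -exprS !linearZ /= umbralXn Bpm_binomial -mulrN.
congr (_ * - _); rewrite addrC exprDn linear_sum; apply: eq_bigr => j _.
by rewrite expr1n mul1r linearMn /= umbralXn.
Qed.

Lemma umbralM2 p : umbral (2 * p) = 2 * umbral p.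
Proof. by rewrite !mulr_natl linearMn. Qed.

Definition shift2 (p : {poly int}) : {poly int} := p \Po ('X + 2%:P).

Definition fib_poly : {poly int} := 'X ^+ 2 - 'X - 1.

(** Write [q p = X (X - 1) p - p] and apply [umbralMX] twice: the first shift turns [X - 1] into
    [X], which the second one absorbs. *)
Lemma umbral_fibM p : umbral (fib_poly * p) = umbral (shift2 p - p).
Proof.
have -> : fib_poly * p = 'X * (('X - 1) * p) - p by rewrite /fib_poly; ring.
rewrite linearB /= umbralMX rmorphM rmorphB /= comp_polyX rmorph1 addrK.
rewrite umbralMX opprK linearB /= -comp_polyA; congr (umbral (_ \Po _) - _).
by rewrite rmorphD /= comp_polyX rmorph1 polyC_natr; ring.
Qed.

(** * The weight filtration *)

(* The ideal spanned by the [2^a * fib_poly^b] with [2 * a + b >= t]. *)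
Inductive weight : nat -> {poly int} -> Prop :=
| weight0 p : weight 0 p
| weightD t p p' : weight t p -> weight t p' -> weight t (p + p')
| weight_fib t p : weight t p -> weight t.+1 (fib_poly * p)
| weight2 t u p : (u <= t.+2)%N -> weight t p -> weight u (2 * p).

Lemma weightMl t p p' : weight t p' -> weight t (p * p').
Proof.
elim=> {t p'} [p'|t p1 p2 _ IH1 _ IH2|t p' _ IH|t u p' leut _ IH].
- exact: weight0.
- by rewrite mulrDr; apply: weightD.
- by rewrite mulrCA; apply: weight_fib.
- by rewrite mulrCA; apply: weight2 leut _.
Qed.

(** The inequality in [weight2] lets a factor 2 count for less than 2, so a weight can drop by a
    single unit. *)
Lemma weight_pred t p : weight t p -> weight t.-1 p.
Proof.
elim=> {t p} [p|t p1 p2 _ IH1 _ IH2|t p wp _|t u p leut wp _].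
- exact: weight0.
- exact: weightD.
- exact: weightMl.
- by apply: weight2 wp; apply: leq_trans (leq_pred u) leut.
Qed.

Lemma weight_le t u p : (t <= u)%N -> weight u p -> weight t p.
Proof.
by move=> /subnK <-; elim: (u - t)%N => // d IHd /weight_pred; apply: IHd.
Qed.

Lemma weightM t u p p' : weight t p -> weight u p' -> weight (t + u) (p * p').
Proof.
move=> wp wp'; elim: wp => {t p} [p|t p1 p2 _ IH1 _ IH2|t p _ IH|t v p levt _ IH].
- exact: weightMl.
- by rewrite mulrDl; apply: weightD.
- by rewrite -mulrA; apply: weight_fib.
- by rewrite -mulrA; apply: weight2 IH; rewrite -!addSn leq_add2r.
Qed.

Lemma shift2_diff_even p : exists d, shift2 p - p = 2 * d.
Proof.
elim/poly_ind: p => [|p c [d Ed]].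
  by exists 0; rewrite /shift2 comp_poly0 subr0 mulr0.
exists ('X * d + shift2 p).
rewrite /shift2 rmorphD rmorphM /= comp_polyX comp_polyC -/(shift2 p).
have -> : shift2 p = 2 * d + p by rewrite -Ed subrK.
rewrite polyC_natr; ring.
Qed.

Lemma shift2_fib : shift2 fib_poly = fib_poly + 2 * (2 * 'X + 1).
Proof.
rewrite /shift2 /fib_poly !rmorphB rmorphXn /= comp_polyX rmorph1 polyC_natr.
ring.
Qed.

(* Dividing the difference by [2] costs only one unit of weight, since
   [fib_poly] itself shifts by a multiple of [2]. *)
Lemma weight_shift2 t p : weight t p ->
  weight t (shift2 p) /\ exists2 d, shift2 p - p = 2 * d & weight t.-1 d.
Proof.
elim=> {t p} [p|t p1 p2 _ [s1 [d1 E1 w1]] _ [s2 [d2 E2 w2]]|t p wp [sp [d E w]]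
             |t u p leut wp [sp [d E w]]].
- split; first exact: weight0.
  by have [d E] := shift2_diff_even p; exists d => //; apply: weight0.
- rewrite /shift2 rmorphD /= -!/(shift2 _); split; first exact: weightD.
  exists (d1 + d2); last exact: weightD.
  by rewrite mulrDr -E1 -E2; ring.
- rewrite /shift2 rmorphM /= -!/(shift2 _) shift2_fib; split.
    rewrite mulrDl; apply: weightD; first exact: weight_fib.
    by rewrite -mulrA; apply: (weight2 (leqnSn _)); apply: weightMl.
  (* With [q' = q + 2 (2 X + 1)] and [p'] the shifts of [q] and [p]: [q' p' - q p = q (p' - p) + 2
     (2 X + 1) p']. *)
  exists (fib_poly * d + (2 * 'X + 1) * shift2 p).
    have -> : shift2 p = 2 * d + p by rewrite -E subrK.
    ring.
  apply: weightD; last exact: weightMl.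
  case: t w {wp sp} => [|t] w; [exact: weight0 | exact: weight_fib].
- have -> : shift2 (2 * p) = 2 * shift2 p by rewrite /shift2 rmorphM rmorph_nat.
  split; first exact: weight2 leut _.
  exists (2 * d); first by rewrite -E; ring.
  by apply: weight2 w; lia.
Qed.

(** Each factor 2 extracted costs at most two units of weight: for [fib_poly], one for the factor
    itself and one for the halved difference [d]. As [d] is not part of the derivation of [p], an
    outer induction on the weight is used. *)
Lemma dvdz_umbral_weight t p : weight t p -> (2 ^+ uphalf t %| umbral p)%Z.
Proof.
have [n] := ubnP t; elim: n t p => // n IHn t p ltn wp.
elim: wp ltn => {t p} [p|t p1 p2 _ IH1 _ IH2|t p wp _|t u p leut wp IH] ltn.
- by rewrite expr0 dvd1z.
- by rewrite linearD /= rpredD ?IH1 ?IH2.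
- have [_ [d Ed wd]] := weight_shift2 wp.
  rewrite umbral_fibM Ed umbralM2.
  case: t ltn wd {wp} => [|t] ltn wd; first exact: dvdz_mulr.
  by rewrite /= exprS dvdz_mul // IHn // ltnW.
- rewrite umbralM2.
  case: u ltn leut => [|[|u]] ltn leut; rewrite ?expr0 ?dvd1z //.
    exact: dvdz_mulr.
  rewrite /= exprS dvdz_mul //; apply: IHn; first exact: ltnW.
  by apply: weight_le wp; rewrite -2!ltnS.
Qed.

Lemma weight_cube : weight 1 ('X^3 - 1).
Proof.
have -> : 'X^3 - 1 = fib_poly * ('X + 1) + 2 * 'X :> {poly int}.
  by rewrite /fib_poly; ring.
apply: weightD; first by apply: weight_fib; apply: weight0.
exact: (weight2 (t := 0)) (weight0 _).
Qed.

Lemma weight_sqr_sub1 t (p : {poly int}) :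
  weight t (p - 1) -> weight (t + minn t 2) (p ^+ 2 - 1).
Proof.
move=> wp; have -> : p ^+ 2 - 1 = (p - 1) * ((p - 1) + 2 * 1) by ring.
apply: weightM => //; apply: weightD; first exact: weight_le (geq_minl _ _) _.
exact: (weight2 (t := 0)) (geq_minr _ _) (weight0 _).
Qed.

Lemma weight_Xn24_sub1 m : weight (2 * m + 6) ('X^(24 * 2 ^ m) - 1).
Proof.
elim: m => [|m IHm].
  have E k : 'X^(k * 2) = 'X^k ^+ 2 :> {poly int} by rewrite exprM.
  rewrite muln0 muln1 -[24%N]/(3 * 2 * 2 * 2)%N 3!E.
  (* The exponents 3, 6, 12, 24 receive the weights 1, 2, 4, 6. *)
  exact: (weight_sqr_sub1 (weight_sqr_sub1 (weight_sqr_sub1 weight_cube))).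
rewrite expnSr mulnA exprM; have := weight_sqr_sub1 IHm.
by apply: weight_le; lia.
Qed.

(** * Three values of [Bpm] *)

(** One step of [a(n+1,k) = k a(n,k) - a(n,k-1)] for the signed numbers [(-1)^k S(n,k)], over binary
    integers so that row 62 is computable; [p] is the left neighbour. *)
Fixpoint alt_next (p k : Z) (r : seq Z) : seq Z :=
  if r is x :: r' then Z.sub (Z.mul k x) p :: alt_next x (Z.succ k) r'
  else [:: Z.opp p].

Definition alt_row (n : nat) : seq Z :=
  iter n (alt_next Z0 Z0) [:: Zpos xH].

Definition BpmZ (n : nat) : Z := foldr Z.add Z0 (alt_row n).

Lemma nth_alt_next p k r i :
  nth Z0 (alt_next p k r) i =
  (k + i%:R) * nth Z0 r i - (if i is i'.+1 then nth Z0 r i' else p).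
Proof.
elim: r p k i => [|x r IHr] p k [|i] /=; rewrite ?mulr0 ?sub0r ?addr0 //.
  by rewrite nth_nil; case: i => [|i]; rewrite ?nth_nil.
rewrite IHr; congr (_ * _ - _); last by case: i.
by rewrite -addn1 natrD (addrC i%:R) addrA.
Qed.

Lemma size_alt_next p k r : size (alt_next p k r) = (size r).+1.
Proof. by elim: r p k => //= x r IHr p k; rewrite IHr. Qed.

Lemma size_alt_row n : size (alt_row n) = n.+1.
Proof. by elim: n => //= n IHn; rewrite size_alt_next IHn. Qed.

Lemma nth_alt_row n i :
  int_of_Z (nth Z0 (alt_row n) i) = (-1) ^+ i * (stirling2 n i)%:Z.
Proof.
elim: n i => [|n IHn] i; first by case: i => [|[|i]] //=; rewrite mulr0.
rewrite /alt_row iterS -/(alt_row n) nth_alt_next rmorphB rmorphM rmorphD /=.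
rewrite rmorph_nat IHn; case: i => [|i].
  by rewrite addr0 mul0r mulr0.
by rewrite IHn exprS /= PoszD PoszM natz; ring.
Qed.

Lemma BpmZE n : int_of_Z (BpmZ n) = Bpm n.
Proof.
rewrite /Bpm -(size_alt_row n).
under eq_bigr => k _ do rewrite -nth_alt_row.
rewrite -rmorph_sum /= -(big_nth Z0 xpredT id) /BpmZ.
by congr int_of_Z; rewrite unlock.
Qed.

Lemma dvdz_int_of_Z (a b : Z) : Z.eqb (Z.modulo b a) Z0 ->
  (int_of_Z a %| int_of_Z b)%Z.
Proof.
move=> /Z.eqb_spec; case: (Z.eqb_spec a Z0) => [->|a0]; first by case: b.
by move=> /(Z.div_exact _ _ a0) ->; rewrite rmorphM dvdz_mulr.
Qed.

Lemma Bpm14_mod32 : (2 ^+ 5 %| Bpm 14)%Z.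
Proof. by rewrite -BpmZE; apply: (@dvdz_int_of_Z (Zpos 32)); vm_compute. Qed.

Lemma Bpm38_mod64 : (2 ^+ 6 %| Bpm 38 - Bpm 14 - 2 ^+ 5)%Z.
Proof.
have E a b : int_of_Z a - int_of_Z b - 2 ^+ 5 = int_of_Z (a - b - Zpos 32)%R.
  by rewrite !rmorphB.
rewrite -!BpmZE E.
by apply: (@dvdz_int_of_Z (Zpos 64)); vm_compute.
Qed.

(** This is the second difference of [Bpm (24 * n + 14)] at [n = 0]. *)
Lemma Bpm62_mod128 : (2 ^+ 7 %| Bpm 62 - 2 * Bpm 38 + Bpm 14)%Z.
Proof.
have E a b c :
    int_of_Z a - 2 * int_of_Z b + int_of_Z c = int_of_Z (a - Zpos 2 * b + c)%R.
  by rewrite rmorphD rmorphB rmorphM.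
rewrite -!BpmZE E.
by apply: (@dvdz_int_of_Z (Zpos 128)); vm_compute.
Qed.

(** * The increments of [n |-> Bpm (24 * n + 14)] *)

Definition Bpm24 (n : nat) : int := Bpm (24 * n + 14)%N.

Definition inc (m : nat) : {poly int} := 'X^(24 * 2 ^ m) - 1.

Lemma incS m : inc m.+1 = inc m ^+ 2 + 2 * inc m.
Proof. by rewrite /inc expnSr mulnA exprM; ring. Qed.

Lemma umbral_inc m n :
  umbral ('X^(24 * n + 14) * inc m) = Bpm24 (n + 2 ^ m) - Bpm24 n.
Proof.
rewrite /inc mulrBr mulr1 -exprD linearB /= !umbralXn; congr (Bpm _ - _); lia.
Qed.

(** The weight of [inc m] is [2 * (m + 3)], and half of the total weight survives as a power of
    2. *)
Lemma dvdz_umbral_inc m k d p : (d <= (m + 3) * k)%N ->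
  (2 ^+ d %| umbral (p * inc m ^+ k))%Z.
Proof.
move=> led; have wk : weight (((m + 3) * k).*2) (inc m ^+ k).
  elim: k {led} => [|k IHk]; first by rewrite muln0; apply: weight0.
  rewrite exprS; apply: weight_le (weightM (weight_Xn24_sub1 m) IHk); lia.
have := dvdz_umbral_weight (weightMl p wk); rewrite uphalf_double.
by apply: dvdz_trans; apply: dvdz_exp2l.
Qed.

(** Since [X^24 = inc 0 + 1], a step in [n] costs one more factor [inc 0]; this drives the
    inductions on [n] below. *)
Lemma Xn24S n p : 'X^(24 * n.+1 + 14) * p =
  'X^(24 * n + 14) * (inc 0 * p) + 'X^(24 * n + 14) * p.
Proof.
rewrite -mulrDr -[X in _ + X]mul1r -mulrDl subrK mulrA -exprD.
by congr ('X^_ * _); lia.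
Qed.

Lemma umbral_inc0_mod64 n :
  (2 ^+ 6 %| umbral ('X^(24 * n + 14) * inc 0) - 2 ^+ 5)%Z.
Proof.
elim: n => [|n IHn]; first by rewrite umbral_inc; exact: Bpm38_mod64.
(* The extra term contains [inc 0 ^+ 2], which already gives [2 ^+ 6]. *)
rewrite Xn24S -expr2 linearD -addrA.
by rewrite rpredD // dvdz_umbral_inc.
Qed.

(* The filtration only gives [2 ^+ 6] here; the last factor [2] is numerical. *)
Lemma umbral_inc0_sqr_mod128 n :
  (2 ^+ 7 %| umbral ('X^(24 * n + 14) * inc 0 ^+ 2))%Z.
Proof.
elim: n => [|n IHn]; last first.
  rewrite Xn24S -exprS linearD.
  by rewrite rpredD // dvdz_umbral_inc.
have -> : 'X^(24 * 0 + 14) * inc 0 ^+ 2 = 'X^62 - 2 * 'X^38 + 'X^14.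
  by rewrite /inc; ring.
rewrite linearD linearB /= umbralM2 !umbralXn; exact: Bpm62_mod128.
Qed.

Lemma umbral_inc_mod m n :
  (2 ^+ (m + 6) %| umbral ('X^(24 * n + 14) * inc m) - 2 ^+ (m + 5))%Z.
Proof.
elim: m => [|m IHm]; first exact: umbral_inc0_mod64.
rewrite incS mulrDr [_ * (2 * _)]mulrCA linearD /= umbralM2 -addrA !addSn.
rewrite [X in _ - X]exprS -mulrBr rpredD //; last by rewrite exprS dvdz_mul.
(* For [inc m ^+ 2] the filtration gives exponent [2 * m + 6], which reaches the required [m + 7]
   once [m >= 1]. *)
case: m {IHm} => [|m]; first exact: umbral_inc0_sqr_mod128.
by apply: dvdz_umbral_inc; lia.
Qed.

Lemma Bpm24_add m n k :
  (2 ^+ (m + 6) %| Bpm24 (n + k * 2 ^ m) - Bpm24 n - 2 ^+ (m + 5) * k%:R)%Z.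
Proof.
elim: k => [|k IHk]; first by rewrite mul0n addn0 subrr mulr0 subrr dvdz0.
have := umbral_inc_mod m (n + k * 2 ^ m).
rewrite umbral_inc -addnA -mulSnr => H; rewrite -(rpredDr _ IHk) in H.
by move: H; congr (_ %| _)%Z; rewrite -natr1; ring.
Qed.

Lemma Bpm24_mod32 n : (2 ^+ 5 %| Bpm24 n)%Z.
Proof.
have := Bpm24_add 0 0 n; rewrite muln1 !add0n => H.
have {H} : (2 ^+ 5 %| Bpm24 n - Bpm24 0 - 2 ^+ 5 * n%:R)%Z.
  by apply: dvdz_trans H; apply: dvdz_exp2l.
rewrite rpredBr; last exact: dvdz_mulr.
by rewrite rpredBr // Bpm14_mod32.
Qed.

(** Both arguments are reached from their common residue in steps of [2 ^ m]. Only the parity of the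
    quotient difference matters, that is, whether the digits at [m] differ. *)
Lemma Bpm24_eqmod m n n' : n = n' %[mod 2 ^ m] ->
  (2 ^+ (m + 6) %|
   Bpm24 n - Bpm24 n' - 2 ^+ (m + 5) * ((n %/ 2 ^ m)%:R - (n' %/ 2 ^ m)%:R))%Z.
Proof.
move=> eqn; have := Bpm24_add m (n %% 2 ^ m) (n %/ 2 ^ m).
have := Bpm24_add m (n' %% 2 ^ m) (n' %/ 2 ^ m).
have modK a : (a %% 2 ^ m + a %/ 2 ^ m * 2 ^ m)%N = a by rewrite addnC -divn_eq.
rewrite !modK eqn => H' H.
by have := rpredB H H'; congr (_ %| _)%Z; ring.
Qed.

(** * The digits of the zero *)

Lemma enat_gtn_nu2 a d : enat_gtn (nu2 a) d = (2 ^+ d.+1 %| a)%Z.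
Proof.
rewrite /nu2; case: eqP => [->|/eqP a0] /=; first by rewrite dvdz0.
by rewrite dvdzE abszX /= pfactor_dvdn // absz_gt0.
Qed.

Lemma nu2_eq_Some a d :
  (2 ^+ d %| a)%Z -> ~~ (2 ^+ d.+1 %| a)%Z -> nu2 a = Some d.
Proof.
rewrite -enat_gtn_nu2 /nu2; case: eqP => //= /eqP a0.
rewrite dvdzE abszX /= pfactor_dvdn ?absz_gt0 // -leqNgt => le1 le2.
by congr Some; apply/eqP; rewrite eqn_leq le1 le2.
Qed.

Lemma dvdz_pow2_eq0 (a : int) : (forall d, (2 ^+ d %| a)%Z) -> a = 0.
Proof.
move=> dvda; apply/eqP; apply: contraT => a0.
(* The exponent [|a|] suffices because [|a| < 2 ^ |a|]. *)
have := dvda `|a|%N; rewrite dvdzE abszX /= => /dvdn_leq.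
by rewrite absz_gt0 leqNgt ltn_expl // => /(_ a0).
Qed.

Lemma eqmod_bits m n n' : (forall k, (k < m)%N -> bit n k = bit n' k) ->
  n = n' %[mod 2 ^ m].
Proof.
have modS a k : (a %% 2 ^ k.+1 = bit a k * 2 ^ k + a %% 2 ^ k)%N.
  rewrite {1}(divn_eq a (2 ^ k)) {1}(divn_eq (a %/ 2 ^ k) 2) modn2 -/(bit a k).
  rewrite mulnDl -mulnA -expnS -addnA modnMDl modn_small // expnS.
  have := ltn_pmod a (expn_gt0 2 k); case: (bit a k); lia.
elim: m => [|m IHm] eqb; first by rewrite !modn1.
by rewrite !modS eqb // IHm // => k ltkm; apply: eqb; apply: ltnW.
Qed.

Lemma dvdz_exp2S d (c : int) : (2 ^+ d.+1 %| 2 ^+ d * c)%Z = (2 %| c)%Z.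
Proof. by rewrite exprSr dvdz_mul2l // expf_neq0. Qed.

(** If [Bpm24 (y m)] is an odd multiple of [2 ^+ (m + 5)], then adding [2 ^ m] to [y m] adds
    [2 ^+ (m + 5)] modulo [2 ^+ (m + 6)] and makes the multiple even. *)
Lemma Bpm24_y m : (2 ^+ (m + 5) %| Bpm24 (y m))%Z.
Proof.
elim: m => [|m IHm]; first exact: Bpm24_mod32.
rewrite yS enat_gtn_nu2 -/(Bpm24 _) addSn; case: ifP => // ndvd.
have dvdD : (2 ^+ (m + 5).+1 %| Bpm24 (y m) + 2 ^+ (m + 5))%Z.
  move: IHm ndvd => /dvdzP[c ->]; rewrite [c * _]mulrC dvdz_exp2S => ndvd.
  by rewrite -[X in _ + X]mulr1 -mulrDr dvdz_exp2S; lia.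
have := Bpm24_add m (y m) 1; rewrite mul1n mulr1 [(y m + _)%N]addnC [(m + 6)%N]addnS.
by move=> /rpredD/(_ dvdD); congr (_ %| _)%Z; ring.
Qed.

Theorem theorem7p5 (n : nat) :
  (0 < n)%N -> nu2 (Bpm (24 * n + 14)%N) = enat_addn (mindex n) 5%N.
Proof.
move=> _; rewrite -/(Bpm24 n) /mindex /first_diff.
case: pselect => [ex_neq|all_eq].
  case: ex_minnP => m neqm minm.
  (* The comparison point is [y m.+1]: it has digit [s m] at [m], and its value vanishes modulo
     [2 ^+ (m + 6)]. *)
  have eqy : n = y m.+1 %[mod 2 ^ m].
    apply: eqmod_bits => k ltkm; rewrite sE ?ltnS 1?ltnW //.
    by apply/eqP; apply: contraLR ltkm => /minm; rewrite -leqNgt.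
  have := Bpm24_eqmod eqy; set c := (X in _ - _ * X) => dvdn.
  have {dvdn} : (2 ^+ (m + 6) %| Bpm24 n - 2 ^+ (m + 5) * c)%Z.
    have := Bpm24_y m.+1; rewrite addSnnS => dvdy.
    by have := rpredD dvdn dvdy; congr (_ %| _)%Z; ring.
  have E : Bpm24 n = (Bpm24 n - 2 ^+ (m + 5) * c) + 2 ^+ (m + 5) * c by ring.
  rewrite [(m + 6)%N]addnS => dvdn; apply: nu2_eq_Some; rewrite E.
    rewrite rpredD ?dvdz_mulr //.
    by apply: dvdz_trans dvdn; apply: dvdz_exp2l.
  rewrite rpredDl // dvdz_exp2S /c.
  (* The quotients by [2 ^ m] have the digits at [m] as parities, and these differ, so [c] is
     odd. *)
  move: neqm; rewrite -(sE (ltnSn m)) /bit; lia.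
(* Without a differing digit, [n] is congruent to [y d] modulo [2 ^ d] for every [d], so every power
   of 2 divides [Bpm24 n]. *)
have eqs k : bit n k = s k.
  by apply: contra_notP all_eq => /eqP neqk; exists k.
rewrite (@dvdz_pow2_eq0 (Bpm24 n)) // => d.
have eqy : n = y d %[mod 2 ^ d].
  by apply: eqmod_bits => k ltkd; rewrite sE.
have dvdW e : ((2 : int) ^+ d %| 2 ^+ (d + e))%Z.
  by apply: dvdz_exp2l; apply: leq_addr.
have := dvdz_trans (dvdW 6) (Bpm24_eqmod eqy).
rewrite rpredBr ?dvdz_mulr // rpredBr //.
exact: dvdz_trans (dvdW 5) (Bpm24_y d).
Qed.
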